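(* Let $I\subset\mathbb{R}$ be an interval, let $C: t\mapsto x(t)$, $t\in I$, be a continuous curve in $\mathbb{R}^n$ (that is, $x: I\to\mathbb{R}^n$ is a continuous map), and let $K$ be the convex hull of the curve $C$, i.e. of the set $\{x(t) : t\in I\}$. Then each $v\in K$ can be represented as a convex combination of $n$ or fewer points of the curve $C$.
   Context: Here $n\geq 1$ is an integer. The interval $I$ is arbitrary (not necessarily closed or bounded). Points of the curve $C$ are points of the form $x(t)$ with $t\in I$. *)

(* Defs.v *)
From mathcomp Require Import all_boot all_order all_algebra.
From mathcomp Require Import all_classical all_reals all_analysis.

Set Implicit Arguments.
Unset Strict Implicit.
Unset Printing Implicit Defensive.

Import Order.TTheory GRing.Theory Num.Theory.
Import numFieldNormedType.Exports.

Local Open Scope classical_set_scope.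
Local Open Scope ring_scope.

Definition convex_hull (R : numDomainType) (E : lmodType R) (A : set E)
  : set E := smallest (@convex_set R E) A.

(* The points [p i] may repeat, so [m] bounds the number of points used. *)
Definition convex_combination_of (R : numDomainType) (E : lmodType R)
    (m : nat) (A : set E) (v : E) : Prop :=
  exists (p : 'I_m -> E) (w : 'I_m -> R),
    [/\ forall i, A (p i),
        forall i, 0 <= w i,
        \sum_(i < m) w i = 1 &
        v = \sum_(i < m) w i *: p i].

(* Main.v *)
Require Import Defs.
From mathcomp Require Import all_boot all_order all_algebra.
From mathcomp Require Import all_classical all_reals all_analysis.
Import Order.TTheory GRing.Theory Num.Theory.
Import numFieldNormedType.Exports.
Local Open Scope classical_set_scope.
Local Open Scope ring_scope.

(** The only property of the curve that matters is that its set [A] of points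
    is connected, so the result is the Fenchel-Bunt refinement of
    Caratheodory's theorem ([fenchel_bunt]).

    A representation of [v] is a relation [\sum_i w i *: (p i - v) = 0] with
    nonnegative weights, not all zero; whenever one of the weights vanishes,
    its point can be discarded and the remaining weights normalised
    ([convex_combination_drop]).  So it is enough to show that as long as more
    than [n] points are used, the representation can be changed into one with
    the same number of points and a zero weight.

    Let [p 0, ..., p m] be the points, with [m >= n] and all weights positive.
    If the vectors [p 1 - v, ..., p m - v] are linearly dependent, subtracting
    the right multiple of a dependence relation kills a weight
    ([convex_combination_free]); this is Caratheodory's argument.  Otherwise
    they form a basis.  For a point [y] let [a y] be the coordinates of
    [v - y] in that basis, so that
    [(y - v) + \sum_k a y k *: (p k - v) = 0].  This relation represents [v]
    as soon as all the coordinates are nonnegative, and has a zero weight when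
    their minimum is exactly [0].  That minimum is a continuous function of
    [y], positive at [p 0], because [p 0 - v] is a negative combination of the
    other [p k - v], and negative at [p 1], where one coordinate is [-1].
    Since [A] is connected, the minimum vanishes at some point of [A], which
    then replaces [p 0] ([connected_drop]). *)

Lemma convex_combination_conv (R : numDomainType) (E : lmodType R) (A : set E)
    (m1 m2 : nat) (u v : E) (a b : R) :
  0 <= a -> 0 <= b -> a + b = 1 ->
  convex_combination_of m1 A u -> convex_combination_of m2 A v ->
  convex_combination_of (m1 + m2) A (a *: u + b *: v).
Proof.
move=> a0 b0 ab1 [p [w [Ap w0 w1 ->]]] [q [z [Aq z0 z1 ->]]].
exists (fun i : 'I_(m1 + m2) => match fintype.split i with inl j => p j | inr k => q k end).
exists (fun i : 'I_(m1 + m2) => match fintype.split i with inl j => a * w j | inr k => b * z k end).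
split.
- by move=> i; case: (fintype.split i).
- by move=> i; case: (fintype.split i) => j; rewrite mulr_ge0.
- rewrite big_split_ord /=.
  under eq_bigr do rewrite -[lshift _ _]/(unsplit (inl _)) unsplitK.
  under [X in _ + X]eq_bigr do rewrite -[rshift _ _]/(unsplit (inr _)) unsplitK.
  by rewrite -!mulr_sumr w1 z1 !mulr1.
- rewrite big_split_ord /= !scaler_sumr; congr (_ + _); apply: eq_bigr => i _.
    by rewrite -[lshift _ _]/(unsplit (inl _)) unsplitK scalerA.
  by rewrite -[rshift _ _]/(unsplit (inr _)) unsplitK scalerA.
Qed.

Lemma convex_hull_combination (R : numDomainType) (E : lmodType R) (A : set E)
    (v : E) :
  convex_hull A v -> exists m, convex_combination_of m A v.
Proof.
apply: (@smallest_sub _ _ A [set u | exists m, convex_combination_of m A u]).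
  move=> y z l; rewrite !inE /= => -[m1 cy] [m2 cz].
  exists (m1 + m2)%N; apply: convex_combination_conv => //.
    by rewrite subr_ge0.
  by rewrite addrC subrK.
move=> y Ay; exists 1%N, (fun=> y), (fun=> 1).
by split => //; rewrite big_ord1 ?scale1r.
Qed.

(** Weights of arbitrary positive total are allowed here, and the relation is
    centred at [v]: in this form weights can be altered without keeping track
    of their sum, which is divided out at the end.  The weight at [i1] only
    serves to make that sum positive. *)
Lemma convex_combination_drop (R : numFieldType) (E : lmodType R) (A : set E)
    (m : nat) (v : E) (p : 'I_m.+1 -> E) (w : 'I_m.+1 -> R) (i0 i1 : 'I_m.+1) :
  (forall i, A (p i)) -> (forall i, 0 <= w i) ->
  w i0 = 0 -> 0 < w i1 -> \sum_i w i *: (p i - v) = 0 ->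
  convex_combination_of m A v.
Proof.
move=> Ap w0 wi0 wi1 sum0; pose s := \sum_i w i.
have s_gt0 : 0 < s.
  by rewrite /s (bigD1 i1) //= ltr_pwDl // sumr_ge0.
have sE : s = \sum_i w (lift i0 i) by rewrite /s (bigD1_ord i0) //= wi0 add0r.
exists (p \o lift i0), (fun i => w (lift i0 i) / s); split => //=.
- by move=> i; rewrite divr_ge0 // ltW.
- by rewrite -mulr_suml -sE divff // gt_eqF.
- move: sum0; rewrite (bigD1_ord i0) //= wi0 scale0r add0r.
  under eq_bigr do rewrite scalerBr.
  rewrite sumrB -scaler_suml -sE => /eqP; rewrite subr_eq0 => /eqP sumE.
  under eq_bigr do rewrite mulrC -scalerA.
  by rewrite -scaler_sumr sumE scalerA mulVf ?scale1r // gt_eqF.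
Qed.

(** Caratheodory's exchange: moving the weights along a linear dependence of the
    vectors [p i - v], until the first of them reaches zero, leaves the relation
    true.  The dependence does not involve the vector of index [0], so the
    weight [w ord0] is untouched and not all weights vanish. *)
Lemma convex_combination_free (R : realFieldType) (n m : nat)
    (A : set 'rV[R]_n) (v : 'rV[R]_n) :
  convex_combination_of m.+1 A v ->
  convex_combination_of m A v \/
  exists (p : 'I_m.+1 -> 'rV[R]_n) (w : 'I_m.+1 -> R),
    [/\ forall i, A (p i), forall i, 0 < w i,
        \sum_i w i *: (p i - v) = 0 &
        row_free (\matrix_(i < m) (p (lift ord0 i) - v))].
Proof.
move=> [p [w [Ap w0 w1 vE]]].
have sum0 : \sum_i w i *: (p i - v) = 0.
  under eq_bigr do rewrite scalerBr.
  by rewrite sumrB -scaler_suml w1 scale1r -vE subrr.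
have [i1 wi1] : exists i1, 0 < w i1.
  apply/existsP; apply: contraT; rewrite negb_exists => /forallP wN.
  have : \sum_i w i = 0.
    by apply: big1 => i _; apply/eqP; rewrite eq_le w0 leNgt wN.
  by rewrite w1 => /eqP; rewrite oner_eq0.
have [/forallP wgt0|] := boolP [forall i, 0 < w i]; last first.
  rewrite negb_forall => /existsP [i0 wi0]; left.
  apply: (@convex_combination_drop _ _ _ _ v p w i0 i1) => //.
  by apply/eqP; rewrite eq_le w0 leNgt wi0.
have [Qfree|] := boolP (row_free (\matrix_(i < m) (p (lift ord0 i) - v))).
  by right; exists p, w.
rewrite -kermx_eq0 => /rowV0Pn [c0 /sub_kermxP c0Q c0n0]; left.
(* Up to its sign, the dependence has a positive coefficient, so that
   subtracting a multiple of it lowers some weight. *)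
have [c [cQ [j0 cj0]]] : exists c : 'rV[R]_m,
    c *m (\matrix_(i < m) (p (lift ord0 i) - v)) = 0 /\ exists j, 0 < c 0 j.
  have /rV0Pn [j c0j] := c0n0.
  have [c0j_gt0|c0j_le0] := ltP 0 (c0 0 j); first by
    exists c0; split; last exists j.
  exists (- c0); split; first by rewrite mulNmx c0Q oppr0.
  by exists j; rewrite mxE oppr_gt0 lt_neqAle c0j.
(* [r j] is the multiple of the dependence that cancels the weight of
   [lift ord0 j]; the smallest one keeps all the other weights nonnegative. *)
pose r j := w (lift ord0 j) / c 0 j.
case: (arg_minP r (i0 := j0) (P := fun j => 0 < c 0 j)) => // j cj rmin.
have rj_gt0 : 0 < r j by rewrite divr_gt0.
pose d i := if unlift ord0 i is Some k then c 0 k else 0.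
have sumd0 : \sum_i d i *: (p i - v) = 0.
  rewrite big_ord_recl /d unlift_none scale0r add0r -[RHS]cQ mulmx_sum_row.
  by apply: eq_bigr => k _; rewrite liftK rowK.
apply: (@convex_combination_drop _ _ _ _ v p (fun i => w i - r j * d i)
          (lift ord0 j) ord0) => //.
- move=> i; rewrite subr_ge0 /d; case: unliftP => [k ->|->]; last first.
    by rewrite mulr0.
  have [ck|ck] := ltP 0 (c 0 k); last first.
    by rewrite (le_trans _ (w0 _)) // mulr_ge0_le0 // ltW.
  by rewrite -ler_pdivlMr // rmin.
- by rewrite /d liftK /r divfK ?subrr // gt_eqF.
- by rewrite /d unlift_none mulr0 subr0.
- under eq_bigr do rewrite scalerBl -scalerA.
  by rewrite sumrB sum0 -scaler_sumr sumd0 scaler0 subrr.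
Qed.

Lemma mulmx_coord_continuous (R : realType) (n m : nat) (P : 'M[R]_(n, m))
    (v : 'rV[R]_n) (j : 'I_m) :
  continuous (fun y : 'rV[R]_n => ((v - y) *m P) 0 j).
Proof.
rewrite (_ : (fun _ => _) =
  (fun y : 'rV[R]_n => \sum_(i < n) (v 0 i - y 0 i) * P i j)); last first.
  by apply/funext => y; rewrite mxE; apply: eq_bigr => i _; rewrite !mxE.
apply: continuous_big => [|i _ y]; first exact: add_continuous.
apply: (continuous_comp (g := fun t => (v 0 i - t) * P i j)).
  exact: coord_continuous.
apply: cvgM; last exact: cvg_cst.
by apply: cvgB; [exact: cvg_cst | exact: cvg_id].
Qed.

(** The exchange that uses connectedness.  The set of the [y] for which [v] is a
    combination of [y] and the points [p i], [i > 0], contains [p ord0] but not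
    the other vertices of the simplex; [A] must therefore meet its boundary,
    where some weight is zero. *)
Lemma connected_drop (R : realType) (n m : nat) (A : set 'rV[R]_n)
    (v : 'rV[R]_n) (p : 'I_m.+1 -> 'rV[R]_n) (w : 'I_m.+1 -> R) :
  connected A -> (0 < m)%N -> (n <= m)%N ->
  (forall i, A (p i)) -> (forall i, 0 < w i) ->
  \sum_i w i *: (p i - v) = 0 ->
  row_free (\matrix_(i < m) (p (lift ord0 i) - v)) ->
  convex_combination_of m A v.
Proof.
set Q := \matrix_(_ < m) _ => cA m_gt0 nm Ap w0 sum0 Qfree.
have Qfull : row_full Q.
  by rewrite -col_leq_rank (eqP Qfree).
pose a y : 'rV[R]_m := (v - y) *m pinvmx Q.
have aE y : a y *m Q = v - y by rewrite mulmxKpV // submx_full.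
have aP y (c : 'rV_m) : c *m Q = v - y -> a y = c.
  by move=> cE; apply: (row_free_inj Qfree); rewrite /= aE.
(* The default value [1] only truncates the minimum from above, so it affects
   neither the sign of [g] nor its zeros. *)
pose g y := \big[Num.min/1]_(j < m) a y 0 j.
have cg : continuous g.
  apply: continuous_big => [|j _]; first exact: min_continuous.
  exact: mulmx_coord_continuous.
have gp0 : 0 < g (p ord0).
  apply: lt_bigmin => // j _.
  rewrite (aP _ (\row_k (w (lift ord0 k) / w ord0))) ?mxE ?divr_gt0 //.
  apply: (scalerI (lt0r_neq0 (w0 ord0))).
  rewrite mulmx_sum_row scaler_sumr.
  move: sum0; rewrite big_ord_recl => /eqP.
  rewrite addrC addr_eq0 -scalerN opprB => /eqP <-.
  apply: eq_bigr => k _.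
  by rewrite rowK mxE scalerA mulrC divfK // gt_eqF.
pose j1 := Ordinal m_gt0.
have gp1 : g (p (lift ord0 j1)) < 0.
  rewrite (le_lt_trans (bigmin_le _ j1 _)) //.
  rewrite (aP _ (- delta_mx 0 j1)) ?mxE ?eqxx ?oppr_lt0 //.
  by rewrite mulNmx -rowE rowK opprB.
have [y Ay gy0] : (g @` A) 0.
  have /connected_intervalP itv : connected (g @` A).
    by apply: connected_continuous_connected => //; exact: continuous_subspaceT.
  apply: (itv (g (p (lift ord0 j1))) (g (p ord0))).
  - by exists (p (lift ord0 j1)).
  - by exists (p ord0).
  - by rewrite !ltW.
have a_ge0 j : 0 <= a y 0 j by rewrite -gy0 bigmin_le.
have [j2 aj2] : exists j, a y 0 j = 0.
  have /bigmin_leP [|[j _ aj]] : g y <= 0 by rewrite gy0.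
    by rewrite leNgt ltr01.
  by exists j; apply/eqP; rewrite eq_le aj a_ge0.
apply: (@convex_combination_drop _ _ _ _ v
  (fun i => if unlift ord0 i is Some k then p (lift ord0 k) else y)
  (fun i => if unlift ord0 i is Some k then a y 0 k else 1)
  (lift ord0 j2) ord0).
- by move=> i; case: (unlift _ _).
- by move=> i; case: (unlift _ _).
- by rewrite liftK.
- by rewrite unlift_none.
- rewrite big_ord_recl unlift_none scale1r.
  under eq_bigr do rewrite liftK.
  suff -> : \sum_k a y 0 k *: (p (lift ord0 k) - v) = v - y.
    by rewrite addrC subrKA subrr.
  by rewrite -aE mulmx_sum_row; apply: eq_bigr => k _; rewrite rowK.
Qed.

(** For [n = 0] the statement would fail, since zero points have no convex
    combination; in the proof, [0 < n] provides a second vertex, at which the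
    minimum of the coordinates is negative. *)
Lemma fenchel_bunt (R : realType) (n : nat) (A : set 'rV[R]_n)
    (v : 'rV[R]_n) :
  (0 < n)%N -> connected A -> convex_hull A v ->
  exists2 m : nat, (m <= n)%N & convex_combination_of m A v.
Proof.
move=> n_gt0 cA /convex_hull_combination [m].
elim: m => [|m IH] vm; first by exists 0%N.
have [mn|nm] := leqP m.+1 n; first by exists m.+1.
apply: IH.
have [//|[p [w [Ap w0 sum0 Qfree]]]] := convex_combination_free _ _ _ _ _ vm.
by apply: (connected_drop _ _ _ _ _ p w) => //; exact: leq_trans n_gt0 nm.
Qed.

Theorem theorem3 (R : realType) (n : nat) (hn : (1 <= n)%N)
  (I : set R) (hI : is_interval I)
  (x : R -> 'rV[R]_n) (hx : {within I, continuous x})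
  (v : 'rV[R]_n) (hv : convex_hull (x @` I) v) :
  exists2 m : nat, (m <= n)%N & convex_combination_of m (x @` I) v.
Proof.
apply: fenchel_bunt => //; apply: connected_continuous_connected => //.
exact/connected_intervalP.
Qed.
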